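(* Let $n\ge 1$, let $R>0$, and let $A,B\subset \overline B(0,R)\subset\mathbb{R}^n$ be non-empty compact sets. If $A\cap B=\emptyset$, then the map $$\mathcal{M}id_R:\mathcal{K}(\overline B(0,R))\times \mathcal{K}(\overline B(0,R))\longrightarrow \mathcal{K}(\overline B(0,R)),\qquad (A',B')\longmapsto \{A'=B'\}\cap \overline B(0,R)$$ is continuous at the point $(A,B)$, where $\mathcal{K}(\overline B(0,R))$ carries the topology of the Hausdorff distance (and the product carries the product topology).
   Context: $\mathbb{R}^n$ carries the Euclidean distance $dist$, and $dist(x,A)=\inf_{a\in A}dist(x,a)$ for a non-empty set $A$. For non-empty $A,B\subset\mathbb{R}^n$ the equidistant set (midset) is $\{A=B\}:=\{x\in\mathbb{R}^n : dist(x,A)=dist(x,B)\}$. $\overline B(0,R)$ is the closed ball of radius $R$ centered at the origin. For a compact metric space $X$, $\mathcal{K}(X)$ is the set of non-empty compact subsets of $X$, with the Hausdorff distance $dist_{\mathcal H}(K_1,K_2)=\inf\{\varepsilon>0 : K_1\subset B(K_2,\varepsilon)\text{ and }K_2\subset B(K_1,\varepsilon)\}$, where $B(K,\varepsilon)=\{x\in X : dist(x,K)<\varepsilon\}$. *)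

(* Defs.v *)
From HB Require Import structures.
From mathcomp Require Import all_boot all_order all_algebra.
From mathcomp Require Import all_classical all_reals all_analysis.
From mathcomp Require Import ring.

Set Implicit Arguments.
Unset Strict Implicit.
Unset Printing Implicit Defensive.

Import Order.TTheory GRing.Theory Num.Theory.
Import numFieldNormedType.Exports.

Local Open Scope classical_set_scope.
Local Open Scope ring_scope.

(** An alias of ['rV[R]_n] is needed because the library equips ['rV[R]_n]
    with the sup norm; the alias carries the Euclidean metric instead. *)
Definition euclidean (R : realType) (n : nat) : Type := 'rV[R]_n.

HB.instance Definition _ (R : realType) n :=
  GRing.Lmodule.copy (euclidean R n) 'rV[R]_n.

Definition eucl_dist (R : realType) n (x y : euclidean R n) : R :=
  Num.sqrt (\sum_(i < n) ((x : 'rV[R]_n) ord0 i - (y : 'rV[R]_n) ord0 i) ^+ 2).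

Section euclidean_metric.
Context (R : realType) (n : nat).
Implicit Types x y z : euclidean R n.

Lemma sumsq_ge0 (a : 'I_n -> R) : 0 <= \sum_i a i ^+ 2.
Proof. by apply: sumr_ge0 => i _; exact: sqr_ge0. Qed.

Lemma sum_cauchy_schwarz (a b : 'I_n -> R) :
  (\sum_i a i * b i) ^+ 2 <= (\sum_i a i ^+ 2) * (\sum_i b i ^+ 2).
Proof.
set A := \sum_i a i ^+ 2; set B := \sum_i b i ^+ 2; set C := \sum_i a i * b i.
have [B0|B0] := eqVneq B 0.
  have b0 i : b i = 0.
    apply/eqP; rewrite -sqrf_eq0; apply/eqP.
    by apply: (psumr_eq0P _ B0) => // j _; exact: sqr_ge0.
  by rewrite B0 mulr0 /C big1 ?expr0n// => i _; rewrite b0 mulr0.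
have Bgt0 : 0 < B by rewrite lt_def B0 sumsq_ge0.
have : 0 <= \sum_i (B * a i - C * b i) ^+ 2 by exact: sumsq_ge0.
have -> : \sum_i (B * a i - C * b i) ^+ 2 = B * (A * B - C ^+ 2).
  transitivity (B ^+ 2 * A - 2 * B * C * C + C ^+ 2 * B); last by ring.
  have lin (u v w : R) : u * A - v * C + w * B =
      \sum_i (u * a i ^+ 2 - v * (a i * b i) + w * b i ^+ 2).
    by rewrite /A /B /C !mulr_sumr -sumrB -big_split.
  by rewrite lin; apply: eq_bigr => i _; ring.
by rewrite pmulr_rge0// subr_ge0.
Qed.

Lemma sqrt_sumsq_triangle (a b : 'I_n -> R) :
  Num.sqrt (\sum_i (a i + b i) ^+ 2) <=
  Num.sqrt (\sum_i a i ^+ 2) + Num.sqrt (\sum_i b i ^+ 2).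
Proof.
rewrite -(@ler_pXn2r _ 2)// ?nnegrE ?addr_ge0 ?sqrtr_ge0//.
rewrite sqrrD !sqr_sqrtr ?sumsq_ge0// -sqrtrM ?sumsq_ge0//.
have -> : \sum_i (a i + b i) ^+ 2 =
    \sum_i a i ^+ 2 + (\sum_i a i * b i) *+ 2 + \sum_i b i ^+ 2.
  by rewrite -sumrMnl -!big_split/=; apply: eq_bigr => i _; rewrite sqrrD.
rewrite lerD2r lerD2l lerMn2r/=; apply: le_trans (ler_norm _) _.
by rewrite -sqrtr_sqr ler_sqrt ?mulr_ge0 ?sumsq_ge0// sum_cauchy_schwarz.
Qed.

Lemma eucl_distxx x : eucl_dist x x = 0.
Proof.
by rewrite /eucl_dist big1 ?sqrtr0// => i _; rewrite subrr expr0n.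
Qed.

Lemma eucl_dist_positivity x y : eucl_dist x y = 0 -> x = y.
Proof.
move/eqP; rewrite sqrtr_eq0 => xy0.
have /psumr_eq0P xy : \sum_(i < n)
    ((x : 'rV[R]_n) ord0 i - (y : 'rV[R]_n) ord0 i) ^+ 2 = 0.
  by apply/eqP; rewrite eq_le xy0 sumsq_ge0.
apply/rowP => i; apply/eqP; rewrite -subr_eq0 -sqrf_eq0 xy// => j _.
exact: sqr_ge0.
Qed.

Lemma eucl_dist_sym x y : eucl_dist x y = eucl_dist y x.
Proof.
rewrite /eucl_dist; congr Num.sqrt; apply: eq_bigr => i _.
by rewrite -sqrrN opprB.
Qed.

Lemma eucl_dist_triangle y x z : eucl_dist x z <= eucl_dist x y + eucl_dist y z.
Proof.
apply: le_trans (sqrt_sumsq_triangle _ _).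
by rewrite le_eqVlt; apply/orP; left; apply/eqP; congr Num.sqrt;
  apply: eq_bigr => i _; rewrite addrA subrK.
Qed.

HB.instance Definition _ := isMetric.Build R (euclidean R n)
  eucl_distxx eucl_dist_positivity eucl_dist_sym eucl_dist_triangle.

Lemma mdistE x y : mdist x y = eucl_dist x y. Proof. by []. Qed.

Lemma eucl_distDl x y z : eucl_dist (x + y) (x + z) = eucl_dist y z.
Proof.
rewrite /eucl_dist; congr Num.sqrt; apply: eq_bigr => i _.
rewrite !mxE; ring.
Qed.

Lemma eucl_distZ (t s : R) x :
  eucl_dist (t *: x) (s *: x) = `|t - s| * eucl_dist x 0.
Proof.
rewrite /eucl_dist -sqrtr_sqr -sqrtrM ?sqr_ge0//; congr Num.sqrt.
by rewrite mulr_sumr; apply: eq_bigr => i _; rewrite !mxE; ring.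
Qed.

Lemma eucl_dist_lt x y (e : R) : 0 < e ->
  (forall i, `|(x : 'rV[R]_n) ord0 i - (y : 'rV[R]_n) ord0 i| < e / n.+1%:R) ->
  eucl_dist x y < e.
Proof.
move=> e0 xy.
rewrite -(@ltr_pXn2r _ 2)// ?nnegrE ?sqrtr_ge0 ?ltW// sqr_sqrtr ?sumsq_ge0//.
apply: (@le_lt_trans _ _ (\sum_(i < n) (e / n.+1%:R) ^+ 2)).
  apply: ler_sum => i _; rewrite -[leLHS]real_normK ?num_real//.
  by rewrite ler_pXn2r ?nnegrE// ?ltW// (le_lt_trans _ (xy i)).
rewrite sumr_const card_ord -(mulr_natl _ n) expr_div_n mulrCA.
rewrite gtr_pMr ?exprn_gt0//.
rewrite ltr_pdivrMr ?exprn_gt0// mul1r -natrX ltr_nat.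
by rewrite -mulnn leq_pmulr.
Qed.

End euclidean_metric.

Section metric_notions.
Context {R : realType} {T : metricType R}.
Implicit Types (A B X : set T) (x : T).

Definition set_dist x A : R := inf [set mdist x a | a in A].

Definition midset A B : set T := [set x | set_dist x A = set_dist x B].

Definition cball x (r : R) : set T := [set y | mdist x y <= r].

Definition thickening X A (e : R) : set T := [set x | X x /\ set_dist x A < e].

Record compacts X := Compacts {
  compacts_set :> set T ;
  compacts_neq0 : compacts_set !=set0 ;
  compacts_compact : compact compacts_set ;
  compacts_sub : compacts_set `<=` X }.

Definition hausdorff_dist X (K1 K2 : compacts X) : R :=
  inf [set e | [/\ 0 < e, K1 `<=` thickening X K2 e
                        & K2 `<=` thickening X K1 e]].

End metric_notions.

Section metric_lemmas.
Context {R : realType} {T : metricType R}.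
Implicit Types (A B X : set T) (x y : T).

Lemma set_dist_has_lbound x A : has_lbound [set mdist x a | a in A].
Proof. by exists 0 => _ [a _ <-]; exact: mdist_ge0. Qed.

Lemma set_dist_le x A a : A a -> set_dist x A <= mdist x a.
Proof.
by move=> Aa; apply: ge_inf; [exact: set_dist_has_lbound|exists a].
Qed.

Lemma set_dist_ge0 x A : A !=set0 -> 0 <= set_dist x A.
Proof.
move=> [a Aa]; apply: lb_le_inf; first by exists (mdist x a), a.
by move=> _ [b _ <-]; exact: mdist_ge0.
Qed.

Lemma set_dist0 x A : A x -> set_dist x A = 0.
Proof.
move=> Ax; apply/eqP; rewrite eq_le set_dist_ge0 ?andbT; last by exists x.
by rewrite -(mdistxx x) set_dist_le.
Qed.

Lemma set_dist_ltP x A e : A !=set0 ->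
  set_dist x A < e <-> exists2 a, A a & mdist x a < e.
Proof.
move=> [a0 Aa0]; split=> [xe|[a Aa ae]]; last first.
  exact: le_lt_trans (set_dist_le x Aa) ae.
have hi : has_inf [set mdist x a | a in A].
  by split; [exists (mdist x a0), a0|exact: set_dist_has_lbound].
have e0 : 0 < e - set_dist x A by rewrite subr_gt0.
have [_ [a Aa <-]] := inf_adherent e0 hi.
by rewrite -/(set_dist x A) addrC subrK => ?; exists a.
Qed.

Lemma set_dist_triangle x y A : A !=set0 ->
  set_dist x A <= mdist x y + set_dist y A.
Proof.
move=> A0; rewrite -lerBlDl; apply: lb_le_inf.
  by case: A0 => a Aa; exists (mdist y a), a.
move=> _ [a Aa <-]; rewrite lerBlDl.
exact: le_trans (set_dist_le x Aa) (metric_triangle _ _ _).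
Qed.

Lemma set_dist_continuous A : A !=set0 -> continuous (set_dist ^~ A).
Proof.
move=> A0 x; apply/cvgrPdist_lt => e e0.
have := nbhsx_ballx x _ e0; apply: filterS => y.
rewrite ballEmdist/= => xy; apply: le_lt_trans xy.
rewrite ler_norml lerNl opprB !lerBlDr set_dist_triangle// andbT.
by rewrite metric_sym set_dist_triangle.
Qed.

Lemma closed_midset A B : A !=set0 -> B !=set0 -> closed (midset A B).
Proof.
move=> A0 B0.
have -> : midset A B =
    (fun x => set_dist x A - set_dist x B) @^-1` [set 0].
  apply/seteqP; split => x /=; first by move=> ->; rewrite subrr.
  by move/subr0_eq.
apply: closed_comp => [x _|]; last exact: closed_eq.
by apply: cvgB; exact: set_dist_continuous.
Qed.

Lemma closed_cball x r : closed (cball x r).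
Proof.
have -> : cball x r = (set_dist ^~ [set x]) @^-1` [set s | s <= r].
  by apply/seteqP; split => y /=; rewrite /cball/= /set_dist image_set1 inf1
    metric_sym.
apply: closed_comp => [y _|]; last exact: closed_le.
by apply: set_dist_continuous; exists x.
Qed.

Context (X : set T).
Implicit Types K : compacts X.

HB.instance Definition _ := gen_eqMixin (compacts X).
HB.instance Definition _ := gen_choiceMixin (compacts X).

Lemma eq_compacts K1 K2 : K1 = K2 :> set T -> K1 = K2.
Proof.
case: K1 K2 => [A A0 cA AX] [B B0 cB BX] /= AB; rewrite -{}AB in B0 cB BX *.
by congr Compacts; exact: Prop_irrelevance.
Qed.

Let hset K1 K2 : set R :=
  [set e | [/\ 0 < e, K1 `<=` thickening X K2 e & K2 `<=` thickening X K1 e]].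

Let hset_lb K1 K2 : has_lbound (hset K1 K2).
Proof. by exists 0 => e [/ltW]. Qed.

Let compacts_bounded K x :
  exists2 M, 0 < M & forall y, (K : set T) y -> mdist x y < M.
Proof.
have K0 := compacts_neq0 K.
have cd : {within K, continuous (set_dist ^~ [set x])}.
  by apply: continuous_subspaceT; apply: set_dist_continuous; exists x.
have [c _ Kc] := compact_EVT_max K0 (@compacts_compact _ _ _ K) cd.
have dE y : set_dist y [set x] = mdist x y.
  by rewrite /set_dist image_set1 inf1 metric_sym.
exists (mdist x c + 1); first by rewrite ltr_wpDl ?mdist_ge0.
by move=> y /mem_set /Kc; rewrite !dE => yc; rewrite (le_lt_trans yc)// ltrDl.
Qed.

Let hset_neq0 K1 K2 : hset K1 K2 !=set0.
Proof.
have [a1 Ka1] := compacts_neq0 K1; have [a2 Ka2] := compacts_neq0 K2.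
have [M1 M10 h1] := compacts_bounded K1 a2.
have [M2 M20 h2] := compacts_bounded K2 a1.
exists (M1 + M2); split => [|y Ky|y Ky]; first by rewrite addr_gt0.
- split; first exact: compacts_sub Ky.
  apply/set_dist_ltP; [exact: compacts_neq0|exists a2 => //].
  by rewrite metric_sym (lt_le_trans (h1 _ Ky))// lerDl ltW.
- split; first exact: compacts_sub Ky.
  apply/set_dist_ltP; [exact: compacts_neq0|exists a1 => //].
  by rewrite metric_sym (lt_le_trans (h2 _ Ky))// lerDr ltW.
Qed.

Lemma hausdorff_dist_le K1 K2 e : 0 < e ->
  K1 `<=` thickening X K2 e -> K2 `<=` thickening X K1 e ->
  hausdorff_dist K1 K2 <= e.
Proof. by move=> ? ? ?; apply: ge_inf; [exact: hset_lb|split]. Qed.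

Lemma hausdorff_dist_lt K1 K2 e : hausdorff_dist K1 K2 < e ->
  [/\ 0 < e, K1 `<=` thickening X K2 e & K2 `<=` thickening X K1 e].
Proof.
move=> he.
have hi : has_inf (hset K1 K2) by split.
have h0 : 0 < e - inf (hset K1 K2) by rewrite subr_gt0.
have [d [d0 h1 h2]] := inf_adherent h0 hi.
rewrite addrC subrK => de; split; first exact: lt_trans de.
- by move=> x /h1[? xd]; split => //; exact: lt_trans de.
- by move=> x /h2[? xd]; split => //; exact: lt_trans de.
Qed.

Lemma hausdorff_dist_ge0 K1 K2 : 0 <= hausdorff_dist K1 K2.
Proof. by apply: lb_le_inf; [exact: hset_neq0|move=> e [/ltW]]. Qed.

Lemma hausdorff_distxx K : hausdorff_dist K K = 0.
Proof.
apply/eqP; rewrite eq_le hausdorff_dist_ge0 andbT.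
apply/ler_addgt0Pl => e e0; rewrite addr0.
by apply: hausdorff_dist_le => // x Kx; split; do ?[exact: compacts_sub Kx];
  rewrite set_dist0.
Qed.

Lemma hausdorff_dist_sym K1 K2 : hausdorff_dist K1 K2 = hausdorff_dist K2 K1.
Proof.
by rewrite /hausdorff_dist; congr inf; apply/seteqP; split => e [].
Qed.

Lemma hausdorff_dist_positivity K1 K2 : hausdorff_dist K1 K2 = 0 -> K1 = K2.
Proof.
have sub (L1 L2 : compacts X) : hausdorff_dist L1 L2 = 0 -> L1 `<=` L2.
  move=> h0 x L1x.
  have /closure_id -> :=
    compact_closed (@metric_hausdorff _ T) (@compacts_compact _ _ _ L2).
  move=> B /nbhs_ballP[e /= e0 Be].
  have [_ /(_ x L1x)[_ + ] _] : [/\ 0 < e, L1 `<=` thickening X L2 e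
      & L2 `<=` thickening X L1 e] by apply: hausdorff_dist_lt; rewrite h0.
  move/(set_dist_ltP _ _ (compacts_neq0 L2)) => [y L2y xy].
  by exists y; split => //; apply: Be; rewrite ballEmdist.
move=> h0; apply: eq_compacts; apply/seteqP; split; apply: sub => //.
by rewrite hausdorff_dist_sym.
Qed.

Lemma hausdorff_dist_triangle K2 K1 K3 :
  hausdorff_dist K1 K3 <= hausdorff_dist K1 K2 + hausdorff_dist K2 K3.
Proof.
apply/ler_addgt0Pl => e e0.
have e2 : 0 < e / 2 by rewrite divr_gt0.
have [|p1 a1 b1] := @hausdorff_dist_lt K1 K2 (hausdorff_dist K1 K2 + e / 2).
  by rewrite ltrDl.
have [|p2 a2 b2] := @hausdorff_dist_lt K2 K3 (hausdorff_dist K2 K3 + e / 2).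
  by rewrite ltrDl.
rewrite addrC [e in leRHS]splitr addrACA.
have chain (L1 L2 L3 : compacts X) d1 d2 : L1 `<=` thickening X L2 d1 ->
    L2 `<=` thickening X L3 d2 -> L1 `<=` thickening X L3 (d1 + d2).
  move=> h1 h2 x L1x; split; first exact: compacts_sub L1x.
  have [_ /(set_dist_ltP _ _ (compacts_neq0 L2))[y L2y xy]] := h1 _ L1x.
  have [_ yd] := h2 _ L2y.
  apply: le_lt_trans (set_dist_triangle x y (compacts_neq0 L3)) _.
  exact: ltrD.
apply: hausdorff_dist_le; first exact: addr_gt0.
- exact: chain a1 a2.
- by rewrite addrC; exact: chain b2 b1.
Qed.

HB.instance Definition _ := isMetric.Build R (compacts X)
  hausdorff_distxx hausdorff_dist_positivity hausdorff_dist_sym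
  hausdorff_dist_triangle.

End metric_lemmas.

Section mid.
Context (R : realType) (n : nat) (r : R).
Local Notation E := (euclidean R n).
Local Notation D := (cball (0 : E) r).

Lemma compact_cball : compact D.
Proof.
pose C : set E :=
  [set v | forall i : 'I_n, (v : 'rV[R]_n) ord0 i \in `[- r, r]].
have DC : D `<=` C.
  move=> x; rewrite /D/= mdistE => xr i; rewrite in_itv/= -ler_norml.
  apply: le_trans xr; rewrite -sqrtr_sqr /eucl_dist ler_sqrt ?sumsq_ge0//.
  rewrite (bigD1 i)//= mxE sub0r sqrrN lerDl.
  by apply: sumr_ge0 => j _; exact: sqr_ge0.
apply: subclosed_compact DC; first exact: closed_cball.
have cC : compact (C : set 'rV[R]_n).
  by apply: (@rV_compact R n (fun=> [set` `[- r, r]])) => i;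
    exact: segment_compact.
move=> F PF FC; have [p [Cp Fp]] := cC F PF FC.
exists p; split => // P Q FP /nbhs_ballP[e /= e0 Qe]; apply: Fp => //.
apply/nbhs_ballP; exists (e / n.+1%:R); first by rewrite /= divr_gt0.
move=> y [_ py]; apply: Qe; rewrite ballEmdist/= mdistE.
by apply: eucl_dist_lt => // i; exact: py.
Qed.

Lemma mid_neq0 (A B : compacts D) : midset A B `&` D !=set0.
Proof.
have [a Aa] := compacts_neq0 A; have [b Bb] := compacts_neq0 B.
have A0 := compacts_neq0 A; have B0 := compacts_neq0 B.
pose g (t : R) : E := a + t *: (b - a).
pose f (t : R) := set_dist (g t) A - set_dist (g t) B.
have gc : continuous g.
  move=> t; apply/metricType_numDomainType.cvgrPdist_lt => e e0.
  have d0 : 0 < eucl_dist (b - a) 0 + 1 by rewrite ltr_wpDl ?sqrtr_ge0.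
  near=> s; rewrite mdistE eucl_distDl eucl_distZ.
  apply: (@le_lt_trans _ _ (`|t - s| * (eucl_dist (b - a) 0 + 1))).
    by rewrite ler_wpM2l// lerDl.
  rewrite -ltr_pdivlMr//; near: s.
  by apply: cvgr_dist_lt => //; rewrite divr_gt0.
have fc : continuous f.
  have sc (K : compacts D) : continuous (fun t => set_dist (g t) K).
    move=> t; apply: (@continuous_comp _ _ _ g (set_dist ^~ K)).
      exact: gc.
    exact: (set_dist_continuous (compacts_neq0 K)).
  by move=> t; apply: cvgB; exact: sc.
have g0 : g 0 = a by rewrite /g scale0r addr0.
have g1 : g 1 = b by rewrite /g scale1r addrC subrK.
have f0 : f 0 <= 0.
  by rewrite /f g0 (set_dist0 Aa) sub0r oppr_le0 set_dist_ge0.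
have f1 : 0 <= f 1.
  by rewrite /f g1 (set_dist0 Bb) subr0 set_dist_ge0.
have f01 : Num.min (f 0) (f 1) <= 0 <= Num.max (f 0) (f 1).
  by rewrite ge_min f0 le_max f1 orbT.
have [t] := IVT ler01 (continuous_subspaceT fc) f01.
rewrite in_itv/= => /andP[t0 t1] /subr0_eq ft; exists (g t); split => //.
have gE : g t = (1 - t) *: a + t *: b.
  by rewrite /g scalerBr scalerBl scale1r addrA addrAC.
have := compacts_sub Aa; have := compacts_sub Bb.
rewrite /D/= !mdistE !(eucl_dist_sym 0) => br ar.
apply: le_trans (eucl_dist_triangle (t *: b) _ _) _.
rewrite gE -{2}[t *: b]add0r ![_ + t *: b]addrC eucl_distDl.
rewrite -[X in eucl_dist _ X + _](scale0r a).
rewrite -[X in _ + eucl_dist _ X](scale0r b).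
rewrite !eucl_distZ !subr0 !ger0_norm ?subr_ge0//.
have -> : r = (1 - t) * r + t * r by rewrite -mulrDl subrK mul1r.
by apply: lerD; apply: ler_wpM2l; rewrite ?subr_ge0.
Unshelve. all: by end_near. Qed.

Lemma mid_compact (A B : compacts D) : compact (midset A B `&` D).
Proof.
rewrite setIC; apply: compact_closedI; first exact: compact_cball.
by apply: closed_midset; exact: compacts_neq0.
Qed.

Definition mid (AB : compacts D * compacts D) : compacts D :=
  Compacts (@mid_neq0 AB.1 AB.2) (@mid_compact AB.1 AB.2)
    (@subIsetr _ (midset AB.1 AB.2) D).

End mid.

(* Main.v *)
(** With f = d(., A) - d(., B), the midset of (A, B) is the zero set of f, and f
    moves by at most 2 d when A and B move by d in the Hausdorff distance.
    Points of a perturbed midset have small f, so by compactness of the ball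
    they lie near the midset of (A, B). Conversely, from a point x of the midset
    move slightly towards a nearest point of A, and of B: because A and B are
    disjoint, f becomes negative, resp. positive, by an amount uniform in x.
    The signs survive the perturbation, hence the perturbed f vanishes somewhere
    on the segment joining the two moved points, which stays close to x. *)

Require Import Defs.
From mathcomp Require Import all_boot all_order all_algebra.
From mathcomp Require Import all_classical all_reals all_analysis.
From mathcomp Require Import ring lra.

Import Order.TTheory GRing.Theory Num.Theory.
Import numFieldNormedType.Exports.

Local Open Scope classical_set_scope.
Local Open Scope ring_scope.

(** * Distance functions to compact sets in a metric space *)

Section metric_space.
Set Implicit Arguments.
Unset Strict Implicit.
Context {R : realType} {T : metricType R}.
Implicit Types (A B X : set T) (x y : T).

Lemma set_dist_attained A x : A !=set0 -> compact A ->
  exists2 a, A a & set_dist x A = mdist x a.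
Proof.
(* Reading [mdist x y] as the distance from y to the singleton of x makes its continuity in y a case
   of [set_dist_continuous]. *)
move=> A0 cA; have xE y : set_dist y [set x] = mdist x y.
  by rewrite /set_dist image_set1 inf1 metric_sym.
have cx : {within A, continuous (set_dist ^~ [set x])}.
  by apply: continuous_subspaceT; apply: set_dist_continuous; exists x.
have [a /set_mem Aa amin] := compact_EVT_min A0 cA cx.
exists a => //; apply/eqP; rewrite eq_le set_dist_le//=.
apply: lb_le_inf; first by exists (mdist x a), a.
by move=> _ [b Ab <-]; rewrite -!xE amin// mem_set.
Qed.

(** The continuous function d(., B) attains its minimum on A, and this minimum is positive because A
    misses B. If A or B is empty, any rho serves. *)
Lemma compact_disjoint_gap A B : compact A -> compact B -> A `&` B = set0 ->
  exists2 rho, 0 < rho & forall a b, A a -> B b -> rho <= mdist a b.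
Proof.
move=> cA cB AB0.
have [->|/set0P A0] := eqVneq A set0; first by exists 1.
have [->|/set0P B0] := eqVneq B set0; first by exists 1.
have cd : {within A, continuous (set_dist ^~ B)}.
  exact: continuous_subspaceT (set_dist_continuous B0).
have [a0 /set_mem Aa0 a0min] := compact_EVT_min A0 cA cd.
exists (set_dist a0 B); last first.
  move=> a b Aa Bb; apply: le_trans (set_dist_le a Bb).
  by apply: a0min; rewrite mem_set.
have [b Bb ->] := set_dist_attained a0 B0 cB.
rewrite mdist_gt0; apply/eqP => ab.
by suff: (A `&` B) a0; [rewrite AB0|split => //; rewrite ab].
Qed.

(** Turns one half of Hausdorff closeness into a bound on distance functions that is uniform in
    x. *)
Lemma set_dist_thickening X A B e x : A !=set0 -> B !=set0 ->
  A `<=` thickening X B e -> set_dist x B <= set_dist x A + e.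
Proof.
move=> A0 B0 AB; rewrite -lerBlDr; apply: lb_le_inf.
  by case: A0 => a Aa; exists (mdist x a), a.
move=> _ [a Aa <-]; have [_ /ltW aBe] := AB _ Aa.
by rewrite lerBlDr (le_trans (set_dist_triangle x a B0))// lerD2l.
Qed.

(** The points of X at distance at least e from the midset form a compact set C on which |f| never
    vanishes; m is the minimum of |f| on C, or 1 if C is empty. *)
Lemma near_midset X A B e : compact X -> A !=set0 -> B !=set0 -> 0 < e ->
  midset A B `&` X !=set0 ->
  exists2 m, 0 < m & forall x, X x -> `|set_dist x A - set_dist x B| < m ->
    set_dist x (midset A B `&` X) < e.
Proof.
move=> cX A0 B0 e0 M0; set M := midset A B `&` X.
pose C := X `&` [set x | e <= set_dist x M].
have cC : compact C.
  apply: compact_closedI => //.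
  have -> : [set x | e <= set_dist x M] =
      (set_dist ^~ M) @^-1` [set s | e <= s] by [].
  apply: preimage_closed => [x _|]; last exact: closed_ge.
  exact: set_dist_continuous.
have [C0|/set0P C0] := eqVneq C set0.
  exists 1 => // x Xx _; rewrite ltNge; apply/negP => ex.
  by suff: C x; [rewrite C0|split].
have cf : {within C, continuous (fun x => `|set_dist x A - set_dist x B|)}.
  apply: continuous_subspaceT => x; apply: cvg_norm.
  by apply: cvgB; exact: set_dist_continuous.
have [c /set_mem[Xc ec] cmin] := compact_EVT_min C0 cC cf.
exists `|set_dist c A - set_dist c B|.
  rewrite normr_gt0; apply/eqP => /subr0_eq cAB.
  by move: ec; rewrite /= set_dist0 ?leNgt ?e0.
move=> x Xx; rewrite !ltNge; apply: contra => ex.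
by apply: cmin; rewrite mem_set.
Qed.

End metric_space.

(** * Segments in Euclidean space *)

Section euclidean_space.
Set Implicit Arguments.
Unset Strict Implicit.
Context {R : realType} {n : nat}.
Local Notation E := (euclidean R n).
Implicit Types (A B : set E) (x y p q a b c : E) (t r : R).

(** Stewart's theorem for the cevian from b to the line through x and a; it is a polynomial identity
    in each coordinate. *)
Lemma eucl_dist_stewart t x a b :
  eucl_dist (x + t *: (a - x)) b ^+ 2 =
  (1 - t) * eucl_dist x b ^+ 2 + t * eucl_dist a b ^+ 2
    - t * (1 - t) * eucl_dist x a ^+ 2.
Proof.
rewrite /eucl_dist !sqr_sqrtr ?sumsq_ge0// !mulr_sumr -big_split -sumrB/=.
by apply: eq_bigr => i _; rewrite !mxE; ring.
Qed.

(** Balls are convex: drop the subtracted term in Stewart's identity. *)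
Lemma cball_segment c r p q t : cball c r p -> cball c r q -> 0 <= t <= 1 ->
  cball c r (p + t *: (q - p)).
Proof.
rewrite /cball/= !mdistE !(eucl_dist_sym c) => cp cq /andP[t0 t1].
have r0 : 0 <= r by apply: le_trans cp; exact: sqrtr_ge0.
rewrite -(@ler_pXn2r _ 2)// ?nnegrE ?sqrtr_ge0// eucl_dist_stewart.
have dist_sq u : eucl_dist u c <= r -> eucl_dist u c ^+ 2 <= r ^+ 2.
  by move=> ur; rewrite ler_pXn2r// nnegrE sqrtr_ge0.
have t1' : 0 <= 1 - t by rewrite subr_ge0.
have : 0 <= t * (1 - t) * eucl_dist p q ^+ 2.
  by rewrite mulr_ge0 ?sqr_ge0// mulr_ge0.
have := ler_wpM2l t1' (dist_sq _ cp); have := ler_wpM2l t0 (dist_sq _ cq).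
lra.
Qed.

Lemma continuous_segment p q : continuous (fun t => p + t *: (q - p)).
Proof.
move=> t; apply/metricType_numDomainType.cvgrPdist_lt => e e0.
(* Adding 1 keeps the Lipschitz constant positive when p = q. *)
have d0 : 0 < eucl_dist (q - p) 0 + 1 by rewrite ltr_wpDl ?sqrtr_ge0.
near=> s; rewrite mdistE eucl_distDl eucl_distZ.
apply: (@le_lt_trans _ _ (`|t - s| * (eucl_dist (q - p) 0 + 1))).
  by rewrite ler_wpM2l// lerDl.
rewrite -ltr_pdivlMr//; near: s.
by apply: cvgr_dist_lt => //; rewrite divr_gt0.
Unshelve. all: by end_near. Qed.

(** Intermediate value theorem for f along the segment from p to q. *)
Lemma midset_segment A B p q : A !=set0 -> B !=set0 ->
  set_dist p A <= set_dist p B -> set_dist q B <= set_dist q A ->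
  exists2 t, 0 <= t <= 1 & midset A B (p + t *: (q - p)).
Proof.
move=> A0 B0 pAB qBA.
pose g t : E := p + t *: (q - p).
pose f t := set_dist (g t) A - set_dist (g t) B.
have sc (K : set E) : K !=set0 -> continuous (fun t => set_dist (g t) K).
  move=> K0 t; apply: (@continuous_comp _ _ _ g (set_dist ^~ K)).
    exact: continuous_segment.
  exact: set_dist_continuous.
have fc : continuous f by move=> t; apply: cvgB; exact: sc.
have f0 : f 0 <= 0 by rewrite /f /g scale0r addr0 subr_le0.
have f1 : 0 <= f 1 by rewrite /f /g scale1r [p + _]addrC subrK subr_ge0.
have f01 : Num.min (f 0) (f 1) <= 0 <= Num.max (f 0) (f 1).
  by rewrite ge_min f0 le_max f1 orbT.
have [t] := IVT ler01 (continuous_subspaceT fc) f01.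
by rewrite in_itv/= => t01 /subr0_eq ft; exists t.
Qed.

(* Moving from x a fraction t of the way towards its nearest point a of A
   brings the distance to A down to (1 - t) d(x, A), whereas Stewart's identity
   keeps the squared distance to B above (1 - t)^2 d(x, A)^2 + t rho^2. *)
Lemma move_towards A B r rho t d x : compact A -> A !=set0 ->
    compact B -> B !=set0 ->
    A `<=` cball (0 : E) r -> B `<=` cball (0 : E) r ->
    cball (0 : E) r x ->
    (forall a b, A a -> B b -> rho <= mdist a b) -> 0 <= rho ->
    set_dist x A <= set_dist x B -> 0 <= t <= 1 -> 0 <= d ->
    8 * r * d < t * rho ^+ 2 ->
  exists p, [/\ cball (0 : E) r p, cball x (2 * r * t) p &
    set_dist p A + 2 * d < set_dist p B].
Proof.
move=> cA A0 cB B0 AD BD xD AB rho0 xAB t01 d0 drho.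
have [a Aa xa] := set_dist_attained x A0 cA.
set p := x + t *: (a - x).
have diam y z : cball (0 : E) r y -> cball (0 : E) r z -> mdist y z <= 2 * r.
  rewrite /cball/= => yr zr; apply: le_trans (metric_triangle y (0 : E) z) _.
  by rewrite mulr_natl mulr2n lerD// metric_sym.
have pD : cball (0 : E) r p by apply: cball_segment => //; exact: AD.
have [t0 t1] := andP t01.
have pa2 : mdist p a = (1 - t) * mdist x a.
  apply/eqP; rewrite -(@eqrXn2 _ 2)// ?mulr_ge0 ?mdist_ge0 ?subr_ge0//.
  by rewrite !mdistE eucl_dist_stewart eucl_distxx; apply/eqP; ring.
have px2 : mdist x p = t * mdist x a.
  apply/eqP; rewrite -(@eqrXn2 _ 2)// ?mulr_ge0 ?mdist_ge0//.
  rewrite !mdistE eucl_dist_sym eucl_dist_stewart eucl_distxx.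
  by rewrite (eucl_dist_sym a); apply/eqP; ring.
exists p; split => //.
  by rewrite /cball/= px2 mulrC ler_wpM2r// diam//; exact: AD.
have [b Bb ->] := set_dist_attained p B0 cB.
apply: (@le_lt_trans _ _ (mdist p a + 2 * d)).
  by rewrite lerD2r set_dist_le.
have pb2 : (mdist p a) ^+ 2 + t * rho ^+ 2 <= (mdist p b) ^+ 2.
  rewrite pa2 [in leRHS]mdistE eucl_dist_stewart -!mdistE.
  have xab : mdist x a ^+ 2 <= mdist x b ^+ 2.
    rewrite ler_pXn2r ?nnegrE ?mdist_ge0// -xa (le_trans xAB)//.
    exact: set_dist_le.
  have rab : rho ^+ 2 <= mdist a b ^+ 2.
    by rewrite ler_pXn2r ?nnegrE ?mdist_ge0//; exact: AB.
  nra.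
have := diam _ _ pD (AD _ Aa); have := diam _ _ pD (BD _ Bb).
have := mdist_ge0 p a; have := mdist_ge0 p b; move: pb2 drho d0.
move: (mdist p a) (mdist p b) (t * rho ^+ 2) => v u k uv2 kd d0 u0 v0 ur vr.
(* If u - v <= 2 d, then u^2 - v^2 <= 2 d (u + v) <= 8 r d < k, against [uv2]. *)
rewrite ltNge; apply/negP => uv.
have : (u - v) * (u + v) <= 2 * d * (u + v).
  by rewrite ler_wpM2r ?addr_ge0// lerBlDl.
have : 2 * d * (u + v) <= 2 * d * (4 * r).
  by rewrite ler_wpM2l ?mulr_ge0//; lra.
lra.
Qed.

End euclidean_space.

Theorem theorem6 (R : realType) (n : nat) (n_ge1 : (1 <= n)%N)
    (r : R) (r_gt0 : 0 < r) (A B : compacts (cball (0 : euclidean R n) r))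
    (AB0 : A `&` B = set0) :
  {for (A, B), continuous (@mid R n r)}.
Proof.
have cA := @compacts_compact _ _ _ A; have cB := @compacts_compact _ _ _ B.
have A0 := compacts_neq0 A; have B0 := compacts_neq0 B.
have AD := @compacts_sub _ _ _ A; have BD := @compacts_sub _ _ _ B.
apply/metricType_numDomainType.cvgrPdist_lt => e e0.
have e2 : 0 < e / 2 by rewrite divr_gt0.
have [m m0 midm] := near_midset (@compact_cball R n r) A0 B0 e2
  (mid_neq0 A B).
have [rho rho0 gap] := compact_disjoint_gap cA cB AB0.
(* A move by the fraction t has length at most 2 r t <= e / 4. *)
pose t := Num.min 1 (e / (8 * r)).
have t0 : 0 < t by rewrite lt_min ltr01 divr_gt0// mulr_gt0.
have t01 : 0 <= t <= 1 by rewrite ltW//= ge_min lexx.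
have te : 2 * r * t < e / 2.
  apply: (@le_lt_trans _ _ (2 * r * (e / (8 * r)))).
    by rewrite ler_pM2l ?mulr_gt0// ge_min lexx orbT.
  have -> : 2 * r * (e / (8 * r)) = e / 4 by field; lra.
  lra.
(* The first bound serves the perturbed midset, where |f| <= 2 d must stay below m; the second is
   the requirement of [move_towards]. *)
pose d := Num.min (m / 4) (t * rho ^+ 2 / (16 * r)).
have d0 : 0 < d.
  by rewrite lt_min !divr_gt0 ?mulr_gt0 ?exprn_gt0.
have dm : 2 * d < m.
  have : d <= m / 4 by rewrite ge_min lexx.
  lra.
have drho : 8 * r * d < t * rho ^+ 2.
  have k0 : 0 < t * rho ^+ 2 by rewrite mulr_gt0 ?exprn_gt0.
  apply: (@le_lt_trans _ _ (8 * r * (t * rho ^+ 2 / (16 * r)))).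
    by rewrite ler_pM2l ?mulr_gt0// ge_min lexx orbT.
  have -> : 8 * r * (t * rho ^+ 2 / (16 * r)) = t * rho ^+ 2 / 2 by field; lra.
  lra.
exists (ball A d, ball B d); first by split; exact: nbhsx_ballx.
move=> [A' B'] [/= + +]; rewrite !ballEmdist/=.
move=> /hausdorff_dist_lt[_ AA' A'A] /hausdorff_dist_lt[_ BB' B'B].
have A'0 := compacts_neq0 A'; have B'0 := compacts_neq0 B'.
have dA x : set_dist x A' <= set_dist x A + d by exact: set_dist_thickening AA'.
have dA' x : set_dist x A <= set_dist x A' + d.
  by exact: set_dist_thickening A'A.
have dB x : set_dist x B' <= set_dist x B + d by exact: set_dist_thickening BB'.
have dB' x : set_dist x B <= set_dist x B' + d.
  by exact: set_dist_thickening B'B.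
(* The infimum yields only a non-strict bound, hence the passage to e / 2. *)
apply: (@le_lt_trans _ _ (e / 2)); last by lra.
apply: hausdorff_dist_le => // x /= [xM xD]; split => //; last first.
  apply: midm => //; apply: le_lt_trans dm; rewrite ler_norml.
  have := dA x; have := dA' x; have := dB x; have := dB' x.
  by move: xM; rewrite /midset/= => ->; lra.
apply/set_dist_ltP; first exact: mid_neq0.
have xAB : set_dist x A <= set_dist x B by rewrite xM.
have xBA : set_dist x B <= set_dist x A by rewrite xM.
have gap' b a : (B : set _) b -> (A : set _) a -> rho <= mdist b a.
  by move=> Bb Aa; rewrite metric_sym gap.
have [p [pD xp pAB]] := move_towards cA A0 cB B0 AD BD xD gap
  (ltW rho0) xAB t01 (ltW d0) drho.
have [q [qD xq qBA]] := move_towards cB B0 cA A0 BD AD xD gap'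
  (ltW rho0) xBA t01 (ltW d0) drho.
(* The margin 2 d absorbs a change by d in each of the two distances. *)
have pA'B' : set_dist p A' <= set_dist p B'.
  by have := dA p; have := dB' p; lra.
have qB'A' : set_dist q B' <= set_dist q A'.
  by have := dB q; have := dA' q; lra.
have [s s01 sM] := midset_segment A'0 B'0 pA'B' qB'A'.
exists (p + s *: (q - p)).
  by split => //; exact: cball_segment.
(* The ball of radius 2 r t about x contains p and q, hence the segment between them. *)
by apply: le_lt_trans te; exact: cball_segment.
Qed.
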